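(* For every $P \in \mathcal{Q}$ there is no randomized Fully PTAS for oracle $P$-MOL.
   Context: A matroid is a pair $(E,\mathcal{I})$ with $E$ finite and $\mathcal{I}\subseteq 2^E$ such that $\emptyset\in\mathcal{I}$, $\mathcal{I}$ is closed under subsets, and for $A,B\in\mathcal{I}$ with $|A|>|B|$ there is $e\in A\setminus B$ with $B\cup\{e\}\in\mathcal{I}$. For a matroid $\mathcal{M}=(E,\mathcal{I})$, $\mathrm{IS}(\mathcal{M})=\mathcal{I}$, $\mathrm{rank}(\mathcal{M})=\max_{T\in\mathcal{I}}|T|$ and $\mathrm{bases}(\mathcal{M})=\{S\in\mathcal{I}: |S|=\mathrm{rank}(\mathcal{M})\}$. For $f:X\to\mathbb{R}_{\ge0}$ and $Y\subseteq X$, $f(Y)=\sum_{e\in Y}f(e)$. Let $\mathcal{P}=\{\max,\min\}\times\{\mathrm{bases},\mathrm{IS}\}\times\{\le,\ge\}$ and $\mathcal{Q}=\mathcal{P}\setminus\{(\min,\mathrm{IS},\le)\}$. For $P=(\mathrm{opt},\mathcal{F},\triangleleft)\in\mathcal{P}$, the $P$-MOL problem: an instance is $(E,\mathcal{I},v,w,L)$ where $\mathcal{M}=(E,\mathcal{I})$ is a matroid, $v,w:E\to\mathbb{R}_{\ge0}$, $L\in\mathbb{R}_{\ge0}$; a solution is $S\subseteq E$ with $S\in\mathcal{F}(\mathcal{M})$ and $w(S)\triangleleft L$; the goal is to $\mathrm{opt}$imize (maximize or minimize) $v(S)$ over solutions. In oracle $P$-MOL, $E,v,w,L$ are given explicitly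 (their encoding is the instance size $|I|$) and $\mathcal{I}$ is accessible only via a membership oracle answering whether a given $S\subseteq E$ lies in $\mathcal{I}$; running time counts oracle queries plus basic operations. For $\rho\ge1$, a $\rho$-approximate solution for an instance $I$ is a solution of value $\ge \mathrm{OPT}(I)/\rho$ for maximization, or $\le\rho\cdot\mathrm{OPT}(I)$ for minimization. A randomized $\rho$-approximation algorithm, given an instance, returns with probability at least $1/2$ a $\rho$-approximate solution if a solution exists, and if no solution exists returns that the instance has no solution. A randomized Fully PTAS is a family $(A_\varepsilon)_{\varepsilon>0}$ where each $A_\varepsilon$ is a randomized $(1+\varepsilon)$-approximation algorithm with running time $(|I|/\varepsilon)^{O(1)}$. *)

(* Defs.v *)
From mathcomp Require Import all_boot all_order all_algebra.
From mathcomp Require Import reals.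

Set Implicit Arguments.
Unset Strict Implicit.
Unset Printing Implicit Defensive.

Import Order.TTheory GRing.Theory Num.Theory.
Local Open Scope ring_scope.

Record matroid (E : finType) := Matroid {
  indep : {set {set E}};
  indep_set0 : set0 \in indep;
  indep_sub : forall A B : {set E}, B \in indep -> A \subset B -> A \in indep;
  indep_exchange : forall A B : {set E},
    A \in indep -> B \in indep -> (#|B| < #|A|)%N ->
    exists2 e, e \in A :\: B & e |: B \in indep }.

Definition rank (E : finType) (M : matroid E) : nat :=
  \max_(T in indep M) #|T|.

Definition bases (E : finType) (M : matroid E) : {set {set E}} :=
  [set S in indep M | #|S| == rank M].

Inductive goal := Max | Min.
Inductive set_system := Bases | IS.
Inductive bound := Le | Ge.
Definition problem : Type := goal * set_system * bound.

Definition in_Q (P : problem) : Prop := P <> (Min, IS, Le).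

(* The explicit part of an instance must have a finite encoding: the ground
   set is {0, ..., n - 1} and the numbers are nonnegative rationals. *)
Record instance := Instance {
  ground : nat;
  matroid_of : matroid 'I_ground;
  profit : 'I_ground -> rat;
  weight : 'I_ground -> rat;
  limit : rat;
  profit_ge0 : forall e, 0 <= profit e;
  weight_ge0 : forall e, 0 <= weight e;
  limit_ge0 : 0 <= limit }.

Definition sum_over (X : finType) (f : X -> rat) (Y : {set X}) : rat :=
  \sum_(e in Y) f e.

Definition nbits (m : nat) : nat := (trunc_log 2 m).+1.

Definition rat_size (x : rat) : nat :=
  (nbits `|numq x| + nbits `|denq x|)%N.

Definition instance_size (I : instance) : nat :=
  (ground I + rat_size (limit I) +
   \sum_(e < ground I) (rat_size (profit e) + rat_size (weight e)))%N.

Section MOL.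
Variables (P : problem) (I : instance).

Definition feasible_family : {set {set 'I_(ground I)}} :=
  match P.1.2 with
  | Bases => bases (matroid_of I)
  | IS => indep (matroid_of I)
  end.

Definition solution (S : {set 'I_(ground I)}) : bool :=
  (S \in feasible_family) &&
  match P.2 with
  | Le => sum_over (@weight I) S <= limit I
  | Ge => limit I <= sum_over (@weight I) S
  end.

Definition optimal (S : {set 'I_(ground I)}) : bool :=
  solution S &&
  [forall T : {set 'I_(ground I)}, solution T ==>
    match P.1.1 with
    | Max => sum_over (@profit I) T <= sum_over (@profit I) S
    | Min => sum_over (@profit I) S <= sum_over (@profit I) T
    end].

(* OPT(I) is the value of any optimal solution T. *)
Definition approx_solution (R : realType) (rho : R) (S : {set 'I_(ground I)})
    : bool :=
  solution S &&
  [exists T : {set 'I_(ground I)}, optimal T &&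
    match P.1.1 with
    | Max => ratr (sum_over (@profit I) T) / rho <= ratr (sum_over (@profit I) S)
    | Min => ratr (sum_over (@profit I) S) <= rho * ratr (sum_over (@profit I) T)
    end].

End MOL.

(* Algorithms are programs of a random access machine with an unbounded bank of
   registers, an indirectly addressed memory, coin flips and a membership
   oracle.  Every instruction costs one unit.  As addition and truncated
   subtraction are the only arithmetic, numbers grow by at most one bit per
   step, so that polynomial time agrees with that of probabilistic oracle
   Turing machines. *)
Inductive instr :=
  | Const of nat & nat
  | Add of nat & nat & nat
  | Sub of nat & nat & nat
  | Read of nat & nat
  | Write of nat & nat
  | Jz of nat & nat
  | Coin of nat
  | Query of nat & nat
  | Return of nat
  | ReturnNoSolution.

Definition program := seq instr.

(* [Halted None] is the answer that the instance has no solution. *)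
Inductive config (n : nat) :=
  | Running of nat & (nat -> nat) & (nat -> nat)
  | Halted of option {set 'I_n}.
Arguments Running {n} _ _ _.

Definition update (f : nat -> nat) (a x : nat) : nat -> nat :=
  fun b => if b == a then x else f b.

(* A set is stored as its characteristic vector in n consecutive cells. *)
Definition set_at (n : nat) (mem : nat -> nat) (a : nat) : {set 'I_n} :=
  [set i : 'I_n | mem (a + i)%N != 0%N].

(* [coin] is the random bit available at this step; only [Coin] looks at it.
   Leaving the program amounts to [ReturnNoSolution]. *)
Definition step (n : nat) (oracle : {set 'I_n} -> bool) (A : program)
    (c : config n) (coin : bool) : config n :=
  match c with
  | Halted out => Halted out
  | Running pc reg mem =>
    match nth ReturnNoSolution A pc with
    | Const d k => Running pc.+1 (update reg d k) mem
    | Add d a b => Running pc.+1 (update reg d (reg a + reg b)%N) mem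
    | Sub d a b => Running pc.+1 (update reg d (reg a - reg b)%N) mem
    | Read d a => Running pc.+1 (update reg d (mem (reg a))) mem
    | Write a b => Running pc.+1 reg (update mem (reg a) (reg b))
    | Jz a l => Running (if reg a == 0%N then l else pc.+1) reg mem
    | Coin d => Running pc.+1 (update reg d coin) mem
    | Query d a => Running pc.+1 (update reg d (oracle (set_at n mem (reg a)))) mem
    | Return a => Halted (Some (set_at n mem (reg a)))
    | ReturnNoSolution => Halted None
    end
  end.

Definition encode_rat (x : rat) : seq nat := [:: `|numq x|%N; `|denq x|%N].

(* Everything but the matroid. *)
Definition encode_instance (I : instance) : seq nat :=
  ground I :: encode_rat (limit I) ++
  flatten [seq encode_rat (profit e) ++ encode_rat (weight e)
          | e <- enum 'I_(ground I)].

Definition init (I : instance) : config (ground I) :=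
  Running 0 (fun=> 0%N) (nth 0%N (encode_instance I)).

Definition run (A : program) (I : instance) (coins : seq bool)
    : config (ground I) :=
  foldl (step (fun S => S \in indep (matroid_of I)) A) (init I) coins.

Definition returned (n : nat) (c : config n) : option (option {set 'I_n}) :=
  if c is Halted out then Some out else None.

Definition halts_within (A : program) (I : instance) (t : nat) : Prop :=
  forall coins : t.-tuple bool, returned (run A I coins) <> None.

Definition prob (R : realType) (t : nat) (event : pred (t.-tuple bool)) : R :=
  #|[set coins | event coins]|%:R / (2 ^ t)%:R.

Definition returns_approx (R : realType) (P : problem) (rho : R) (A : program)
    (I : instance) (coins : seq bool) : bool :=
  if returned (run A I coins) is Some (Some X) then
    approx_solution P rho X
  else false.

(* Once all runs have halted, the outcome no longer depends on t. *)
Definition randomized_approx (R : realType) (P : problem) (rho : R)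
    (A : program) : Prop :=
  forall I : instance, exists2 t : nat, halts_within A I t &
    ((exists S, solution P (I := I) S) ->
       2^-1 <= prob R (fun coins : t.-tuple bool =>
                         returns_approx P rho A I coins)) /\
    (~ (exists S, solution P (I := I) S) ->
       forall coins : t.-tuple bool, returned (run A I coins) = Some None).

(* For eps <= 1 the bound is (|I| / eps) ^ O(1).  It is capped at eps = 1, since
   for eps >= |I| the same formula would demand constant running time. *)
Definition fully_PTAS (R : realType) (P : problem) (A : R -> program) : Prop :=
  (forall eps : R, 0 < eps -> randomized_approx P (1 + eps) (A eps)) /\
  exists c : nat, forall (eps : R) (I : instance), 0 < eps ->
    exists2 t : nat,
      t%:R <= c%:R * ((instance_size I)%:R / Num.min 1 eps) ^+ c &
      halts_within (A eps) I t.

(* Main.v *)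
(** The hard instances hide one set T.  On the ground set {0, ..., 2k - 1},
    any two k-subsets with the same element sum L differ in at least two
    elements, so turning any collection of them into non-bases of the uniform
    matroid of rank k leaves a sparse paving matroid.  Let all of them be
    non-bases except T.  With weights (2k)^2 + e and profits (2k)^2 + e or
    (2k)^2 - e, the set T is the best solution, and since the profits are
    polynomially bounded integers, T is the only (1 + eps)-approximate solution
    for some 1 / eps polynomial in k.  An algorithm must therefore query or
    return T with probability at least 1/2 while running against the oracle in
    which nothing is exempted.  Summing over T bounds the number of
    candidates by twice the running time, but for some L there are at least
    2^k / (2k)^2 of them. *)

Require Import Defs.
From mathcomp Require Import all_boot all_order all_algebra.
From mathcomp Require Import reals.
From mathcomp Require Import zify ring lra.

Set Implicit Arguments.
Unset Strict Implicit.
Unset Printing Implicit Defensive.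

Import Order.TTheory GRing.Theory Num.Theory.

(** * Sparse paving matroids *)

Section SparsePaving.
Variables (E : finType) (k : nat) (F : {set {set E}}).
Hypothesis k_gt0 : (0 < k)%N.
Hypothesis F_card : forall S, S \in F -> #|S| = k.
Hypothesis F_sparse : forall (B : {set E}) e f, e \notin B -> f \notin B ->
  e |: B \in F -> f |: B \in F -> e = f.

Definition paving_indep : {set {set E}} :=
  [set S : {set E} | (#|S| <= k)%N && (S \notin F)].

Lemma paving_indep0 : set0 \in paving_indep.
Proof.
rewrite inE cards0 /=; apply/negP => /F_card; rewrite cards0 => k0.
by move: k_gt0; rewrite -k0.
Qed.

Lemma paving_indep_sub (A B : {set E}) :
  B \in paving_indep -> A \subset B -> A \in paving_indep.
Proof.
rewrite !inE => /andP[leBk BF] sAB.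
rewrite (leq_trans (subset_leq_card sAB) leBk) /=.
apply: contra BF => AF.
suff -> : B = A by [].
by apply/eqP; rewrite eq_sym eqEcard sAB (F_card AF).
Qed.

(** If [A :\: B] has two elements, sparsity allows at most one of them to complete [B] to a member
    of [F], so the other one works. *)
Lemma paving_indep_exchange (A B : {set E}) :
  A \in paving_indep -> B \in paving_indep -> (#|B| < #|A|)%N ->
  exists2 e, e \in A :\: B & e |: B \in paving_indep.
Proof.
rewrite !inE => /andP[leAk AF] /andP[leBk BF] ltBA.
have /card_gt0P[e eAB] : (0 < #|A :\: B|)%N.
  rewrite cardsD subn_gt0 (leq_ltn_trans _ ltBA) //.
  by rewrite subset_leq_card ?subsetIr.
have eB : e \notin B by move: eAB; rewrite inE => /andP[].
have card_add f : f \notin B -> (#|f |: B| <= k)%N.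
  by move=> fB; rewrite cardsU1 fB (leq_trans ltBA).
have [eBF|eBF] := boolP (e |: B \in F); last first.
  by exists e => //; rewrite inE card_add.
(* With a single element to choose, cardinalities force [A = e |: B], so this set is independent
   after all. *)
have [/eqP AB1|AB1] := boolP (#|A :\: B| == 1%N).
  have sAeB : A \subset e |: B.
    apply/subsetP => x xA; rewrite !inE.
    have [xB|xB] := boolP (x \in B); first by rewrite orbT.
    have [a ABa] := cards1P (introT eqP AB1).
    have : x \in A :\: B by rewrite inE xB.
    by move: eAB; rewrite ABa !inE => /eqP-> ->.
  have AeB : A = e |: B.
    by apply/eqP; rewrite eqEcard sAeB cardsU1 eB.
  by rewrite AeB eBF in AF.
have /card_gt0P[f] : (0 < #|(A :\: B) :\ e|)%N.
  by move: AB1; rewrite (cardsD1 e) eAB; case: #|_|.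
rewrite inE in_set1 => /andP[fe fAB].
have fB : f \notin B by move: fAB; rewrite inE => /andP[].
exists f => //; rewrite inE card_add //=.
by apply: contra fe => fBF; apply/eqP/(F_sparse fB eB).
Qed.

Definition paving_matroid : matroid E :=
  Matroid paving_indep0 paving_indep_sub paving_indep_exchange.

Lemma rank_paving (T : {set E}) : T \in paving_indep -> #|T| = k ->
  rank paving_matroid = k.
Proof.
move=> Tind Tk; apply/eqP; rewrite eqn_leq; apply/andP; split.
  by apply/bigmax_leqP => S; rewrite inE => /andP[].
rewrite -[X in X <= _]Tk.
exact: (@leq_bigmax_cond _ _ (fun S : {set E} => #|S|)).
Qed.

End SparsePaving.

(** * Runs of oracle programs *)

Section Runs.
Variable n : nat.
Implicit Types (o : {set 'I_n} -> bool) (A : program) (c : config n).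

(** [Return] counts like [Query], since a program may output the hidden set without having asked
    about it. *)
Definition touch A c : seq {set 'I_n} :=
  match c with
  | Running pc reg mem =>
    match nth ReturnNoSolution A pc with
    | Query _ a | Return a => [:: set_at n mem (reg a)]
    | _ => [::]
    end
  | Halted _ => [::]
  end.

Fixpoint touched o A c (coins : seq bool) : seq {set 'I_n} :=
  if coins is b :: coins' then
    touch A c ++ touched o A (step o A c b) coins'
  else [::].

Lemma size_touched o A c coins : (size (touched o A c coins) <= size coins)%N.
Proof.
elim: coins c => //= b coins IH c; rewrite size_cat -add1n leq_add //.
by case: c => //= pc reg mem; case: (nth _ _ _).
Qed.

Lemma touched_same o o' A (T : {set 'I_n}) c coins :
  (forall S, S != T -> o S = o' S) -> T \notin touched o A c coins ->
  foldl (step o' A) c coins = foldl (step o A) c coins.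
Proof.
move=> oo'; elim: coins c => //= b coins IH c.
rewrite mem_cat negb_or => /andP[Tc Trest].
suff -> : step o' A c b = step o A c b by exact: IH.
case: c Tc {Trest} => //= pc reg mem.
case: (nth _ _ _) => //= d a; rewrite inE eq_sym => ?.
by rewrite oo'.
Qed.

Lemma returned_touched o A (T : {set 'I_n}) c coins :
  returned (foldl (step o A) c coins) = Some (Some T) ->
  returned c = Some (Some T) \/ T \in touched o A c coins.
Proof.
elim: coins c => [|b coins IH] c /=; first by left.
move=> /IH [|Trest]; last by right; rewrite mem_cat Trest orbT.
case: c {IH} => [pc reg mem|out] /=; last by left.
case: (nth _ _ _) => //= a [<-]; by right; rewrite inE eqxx.
Qed.

Lemma foldl_halted o A out coins :
  foldl (step o A) (Halted out) coins = Halted out.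
Proof. by elim: coins. Qed.

End Runs.

(** * Halting times and surplus coins *)

Lemma run_cat A I t (s : t.-tuple bool) s' : halts_within A I t ->
  run A I (s ++ s') = run A I s.
Proof.
move=> /(_ s); rewrite /run foldl_cat.
by case: (foldl _ (init I) s) => // out _; rewrite foldl_halted.
Qed.

Lemma halts_withinW A I t t' : (t <= t')%N ->
  halts_within A I t -> halts_within A I t'.
Proof.
move=> /subnKC <- h s.
have hs : size (take t s) == t by rewrite size_takel // size_tuple leq_addr.
rewrite -(cat_take_drop t s) (run_cat (Tuple hs) _ h).
exact: h (Tuple hs).
Qed.

Lemma card_tuple_prefix t d (e : pred (seq bool)) :
  (forall (s : t.-tuple bool) s', e (s ++ s') = e s) ->
  #|[set s : (t + d).-tuple bool | e s]| =
  (#|[set s : t.-tuple bool | e s]| * 2 ^ d)%N.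
Proof.
move=> e_prefix.
pose cat2 (p : t.-tuple bool * d.-tuple bool) := cat_tuple p.1 p.2.
have cat2_inj : injective cat2.
  move=> [s1 s2] [u1 u2] /(congr1 val) /= /eqP.
  by rewrite eqseq_cat ?size_tuple // => /andP[/eqP/val_inj-> /eqP/val_inj->].
have -> : [set s : (t + d).-tuple bool | e s] =
    cat2 @: setX [set s : t.-tuple bool | e s] [set: d.-tuple bool].
  apply/setP => s; rewrite inE; apply/idP/imsetP => [es|[[u v]]]; last first.
    by rewrite !inE andbT => /= eu ->; rewrite /= e_prefix.
  have hs1 : size (take t s) == t by rewrite size_takel // size_tuple leq_addr.
  have hs2 : size (drop t s) == d by rewrite size_drop size_tuple addKn.
  exists (Tuple hs1, Tuple hs2).
    by rewrite !inE andbT /= -(e_prefix (Tuple hs1) (drop t s)) cat_take_drop.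
  by apply: val_inj; rewrite /= cat_take_drop.
by rewrite card_imset // cardsX cardsT card_tuple card_bool.
Qed.

Local Open Scope ring_scope.

Lemma prob_prefix (R : realType) t t' (e : pred (seq bool)) : (t <= t')%N ->
  (forall (s : t.-tuple bool) s', e (s ++ s') = e s) ->
  prob R (fun s : t'.-tuple bool => e s) =
  prob R (fun s : t.-tuple bool => e s).
Proof.
move=> /subnKC <- e_prefix; rewrite /prob card_tuple_prefix // expnD !natrM.
by rewrite -mulf_div divff ?mulr1 // pnatr_eq0 -lt0n expn_gt0.
Qed.

(** This reconciles the time bound witnessing the success probability with the polynomial one, which
    come from unrelated existentials. *)
Lemma prob_halted (R : realType) P (rho : R) A I t t' :
  halts_within A I t -> halts_within A I t' ->
  prob R (fun s : t'.-tuple bool => returns_approx P rho A I s) =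
  prob R (fun s : t.-tuple bool => returns_approx P rho A I s).
Proof.
move=> ht ht'; suff mono u u' : (u <= u')%N -> halts_within A I u ->
    prob R (fun s : u'.-tuple bool => returns_approx P rho A I s) =
    prob R (fun s : u.-tuple bool => returns_approx P rho A I s).
  by case/orP: (leq_total t t') => le_tt'; [|symmetry]; apply: mono.
move=> le_uu' hu; apply: (@prob_prefix _ _ _ (returns_approx P rho A I)) => //.
by move=> s s'; rewrite /returns_approx run_cat.
Qed.

Local Open Scope nat_scope.

(** * Counting the candidates for the hidden set *)

(** Double counting of the pairs [(c, x)] with [x \in hits c]: there are at least [#|F| * #|C| / 2]
    and at most [#|C| * t] of them. *)
Lemma half_covered_family (C X : finType) (F : {set X}) (t : nat)
    (hits : C -> seq X) :
  (forall c, size (hits c) <= t) -> (0 < #|C|) ->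
  (forall x, x \in F -> #|C| <= 2 * #|[set c | x \in hits c]|) ->
  #|F| <= 2 * t.
Proof.
move=> size_hits C_gt0 covered.
have H : \sum_(x in F) #|C| <= 2 * \sum_(x in F) #|[set c | x \in hits c]|.
  by rewrite big_distrr /=; apply: leq_sum => x /covered.
rewrite sum_nat_const in H.
rewrite -(leq_pmul2r C_gt0); apply: leq_trans H _.
rewrite -mulnA leq_mul2l /=.
have -> : \sum_(x in F) #|[set c | x \in hits c]| =
    (\sum_c #|[set x in F | x \in hits c]|).
  under eq_bigr do rewrite -sum1_card.
  under [RHS]eq_bigr do rewrite -sum1_card.
  rewrite (exchange_big_dep predT) //=; apply: eq_bigr => c _.
  by apply: eq_bigl => x; rewrite !inE.
apply: (@leq_trans (\sum_(c : C) t)); last by rewrite sum_nat_const mulnC.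
apply: leq_sum => c _; apply: leq_trans (size_hits c).
apply: leq_trans (card_size (hits c)); apply: subset_leq_card.
by apply/subsetP => x; rewrite inE => /andP[].
Qed.

(** By Pascal's rule and symmetry, ['C(2k+2, k+1)] is twice ['C(2k+1, k)], hence at least twice
    ['C(2k, k)]. *)
Lemma expn2_le_central_bin k : 2 ^ k <= 'C(k.*2, k).
Proof.
elim: k => // k IH; rewrite doubleS binS.
rewrite -[X in (_ <= X + _)]bin_sub; last by lia.
have -> : (k.*2.+1 - k.+1 = k) by lia.
rewrite addnn -mul2n expnS leq_mul2l /=.
by apply: leq_trans IH _; case: k => // k; rewrite binS leq_addr.
Qed.

Lemma exp_beats_poly C D : exists2 k, (0 < k) & (C * k ^ D < 2 ^ k).
Proof.
(* For this [k], [C * k ^ D] is below [2 ^ (C + 2 * j * D)], and that exponent is at most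
   [(j + 1) ^ 2], hence at most [2 ^ j * 2 ^ j = k]. *)
pose j := (C + 2 * D); exists (2 ^ (2 * j)); first by rewrite expn_gt0.
have ltC : (C < 2 ^ C) by exact: ltn_expl.
have ltj : (j < 2 ^ j) by exact: ltn_expl.
apply: (@leq_trans (2 ^ (C + 2 * j * D))).
  by rewrite expnD -expnM ltn_pmul2r // expn_gt0.
rewrite leq_exp2l // [X in _ <= 2 ^ X]mul2n -addnn expnD.
apply: leq_trans (leq_mul ltj ltj); rewrite /j; nia.
Qed.

(** * The hidden-set instances *)

Definition index_sum n (S : {set 'I_n}) : nat := \sum_(e in S) e.

Lemma index_sum_lt n (S : {set 'I_n}) : 0 < n -> index_sum S < n * n.
Proof.
move=> n_gt0; have -> : (n * n = (\sum_(i < n) n.-1) + n).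
  by rewrite sum_nat_const card_ord; nia.
apply: (@leq_ltn_trans (\sum_(i < n) n.-1)); last first.
  by rewrite -[X in X < _]addn0 ltn_add2l.
rewrite /index_sum [X in (_ <= X)](bigID (mem S)) /=.
apply: leq_trans (leq_addr _ _); apply: leq_sum => i _.
by have := ltn_ord i; lia.
Qed.

Definition level n k L : {set {set 'I_n}} :=
  [set S : {set 'I_n} | (#|S| == k) && (index_sum S == L)].

(** Pigeonhole: the levels partition the [k]-subsets, and index sums take fewer than [n * n + 1]
    values. *)
Lemma central_bin_le_levels k m : 0 < k ->
  (forall L, #|level k.*2 k L| <= m) ->
  'C(k.*2, k) <= k.*2 * k.*2 * m.
Proof.
move=> k_gt0 level_le; set n := k.*2.
have n_gt0 : 0 < n by rewrite double_gt0.
rewrite -[n in 'C(n, _)]card_ord -card_draws -sum1_card.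
rewrite (partition_big (fun S => Ordinal (index_sum_lt S n_gt0)) predT) //=.
rewrite -[X in (_ <= X * _)]card_ord -sum_nat_const; apply: leq_sum => L _.
rewrite sum1dep_card; apply: leq_trans (level_le L).
apply: subset_leq_card; apply/subsetP => S; rewrite !inE => /andP[-> /eqP <-].
by rewrite eqxx.
Qed.

(** The added element is determined as [L] minus the index sum of [B]. *)
Lemma level_sparse n k L (B : {set 'I_n}) e f : e \notin B -> f \notin B ->
  e |: B \in level n k L -> f |: B \in level n k L -> e = f.
Proof.
move=> eB fB; rewrite !inE /index_sum => /andP[_ /eqP].
rewrite big_setU1 //= => sumL /andP[_ /eqP].
rewrite big_setU1 //= -sumL => /eqP; rewrite eqn_add2r => /eqP fe.
by apply: val_inj.
Qed.

Lemma nbits_le m : nbits m <= m.+1.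
Proof.
rewrite /nbits ltnS; case: m => // m.
exact: leq_trans (ltnW (ltn_expl _ _)) (trunc_logP _ _).
Qed.

Lemma rat_size_nat m : rat_size m%:R%R <= m + 2.
Proof.
rewrite /rat_size -[m%:R%R]/(m%:~R%R) numq_int denq_int absz_nat.
by rewrite -addn1 addnA leq_add // addn1 nbits_le.
Qed.

Lemma sum_over_natr (X : finType) (f : X -> nat) (S : {set X}) :
  sum_over (fun e => (f e)%:R%R) S = (\sum_(e in S) f e)%:R%R.
Proof. by rewrite /sum_over natr_sum. Qed.

Section HiddenSet.
Variables (P : problem) (k : nat) (k_gt0 : (0 < k)) (L : nat).
Local Notation n := k.*2.
Implicit Types S T : {set 'I_n}.

(** Here the bound on the weight opposes the goal, so profit may equal weight. In the other cases
    the profit has to decrease with the index sum for the bound to oppose the goal. *)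
Definition aligned : bool :=
  match P.1.1, P.2 with Max, Le | Min, Ge => true | _, _ => false end.

(** The offset [n * n] exceeds every index sum, so cardinality dominates and index sums break
    ties. *)
Definition hidden_weight (e : 'I_n) : nat := n * n + e.
Definition hidden_profit (e : 'I_n) : nat :=
  if aligned then n * n + e else n * n - e.
Definition hidden_limit : nat := k * (n * n) + L.

(** [T] is arbitrary: [set0] lies in no level as [k] is positive, and so yields the reference
    matroid in which no candidate is exempted. *)
Definition hidden_matroid T : matroid 'I_n.
Proof.
apply: (@paving_matroid _ k (level n k L :\ T) k_gt0).
- by move=> S; rewrite !inE => /andP[_ /andP[/eqP]].
- move=> B e f eB fB /setD1P[_ eBL] /setD1P[_ fBL].
  exact: level_sparse eB fB eBL fBL.
Defined.

Definition hidden_instance T : instance :=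
  @Instance n (hidden_matroid T)
    (fun e => (hidden_profit e)%:R%R) (fun e => (hidden_weight e)%:R%R)
    hidden_limit%:R%R
    (fun e => ler0n _ _) (fun e => ler0n _ _) (ler0n _ _).

Lemma hidden_indep T S :
  (S \in indep (hidden_matroid T)) =
  (#|S| <= k) && ((S == T) || (S \notin level n k L)).
Proof. by rewrite !in_set negb_and in_set1 negbK. Qed.

Lemma sum_hidden_weight S :
  \sum_(e in S) hidden_weight e = #|S| * (n * n) + index_sum S.
Proof. by rewrite big_split /= sum_nat_const. Qed.

(** The second identity is additive to avoid truncated subtraction. *)
Lemma sum_hidden_profit S :
  if aligned then (\sum_(e in S) hidden_profit e = #|S| * (n * n) + index_sum S)
  else (\sum_(e in S) hidden_profit e + index_sum S = #|S| * (n * n)).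
Proof.
rewrite /hidden_profit; case: aligned.
  by rewrite big_split /= sum_nat_const.
rewrite -big_split /= -sum_nat_const; apply: eq_bigr => e _.
by have := ltn_ord e; nia.
Qed.

Section Candidate.
Variable T : {set 'I_n}.
Hypothesis T_level : T \in level n k L.

Lemma card_candidate : #|T| = k.
Proof. by move: T_level; rewrite inE => /andP[/eqP]. Qed.

Lemma index_sum_candidate : index_sum T = L.
Proof. by move: T_level; rewrite inE => /andP[_ /eqP]. Qed.

Lemma candidate_indep : T \in indep (hidden_matroid T).
Proof. by rewrite hidden_indep eqxx card_candidate leqnn. Qed.

Lemma rank_hidden : rank (hidden_matroid T) = k.
Proof. exact: rank_paving candidate_indep card_candidate. Qed.

Lemma candidate_solution : solution P (I := hidden_instance T) T.
Proof.
rewrite /solution; apply/andP; split.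
  rewrite /feasible_family; case: (P.1.2); last exact: candidate_indep.
  by rewrite inE rank_hidden card_candidate eqxx candidate_indep.
rewrite [sum_over _ _]sum_over_natr sum_hidden_weight.
rewrite card_candidate index_sum_candidate.
by case: P.2; rewrite ler_nat.
Qed.

Lemma profit_candidate_le : \sum_(e in T) hidden_profit e <= n ^ 3.
Proof.
apply: (@leq_trans (\sum_(e in T) 2 * (n * n))).
  apply: leq_sum => e _; have := ltn_ord e; rewrite /hidden_profit.
  by case: aligned; nia.
by rewrite sum_nat_const card_candidate -mul2n; nia.
Qed.

Lemma other_solution_worse S : in_Q P ->
  solution P (I := hidden_instance T) S -> S != T ->
  match P.1.1 with
  | Max => (\sum_(e in S) hidden_profit e < \sum_(e in T) hidden_profit e)
  | Min => (\sum_(e in T) hidden_profit e < \sum_(e in S) hidden_profit e)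
  end.
Proof.
move=> hQ /andP[famS bndS] ST.
have n_gt0 : 0 < n by rewrite double_gt0.
have [leSk kS] : (#|S| <= k) /\ (P.1.2 = Bases -> #|S| = k).
  move: famS; rewrite /feasible_family; case: (P.1.2); rewrite /=.
    by rewrite in_set rank_hidden hidden_indep => /andP[/andP[-> _] /eqP].
  by rewrite hidden_indep => /andP[->].
(* Any [k]-set of index sum [L] other than [T] is a non-base. Hence the weight bound, tight at [T],
   is strict at every other solution of size [k]. *)
have sumS : #|S| = k -> index_sum S <> L.
  move=> Sk SL; have : S \in indep (hidden_matroid T).
    move: famS; rewrite /feasible_family; case: (P.1.2) => //.
    by rewrite inE => /andP[].
  by rewrite hidden_indep (negbTE ST) inE Sk SL !eqxx andbF.
have ltS := index_sum_lt S n_gt0.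
have small : (#|S| < k) -> (#|S| * (n * n) + index_sum S < k * (n * n)).
  by nia.
have pS := sum_hidden_profit S; have pT := sum_hidden_profit T.
move: bndS pS pT; rewrite [sum_over _ _]sum_over_natr sum_hidden_weight.
rewrite card_candidate index_sum_candidate /= /hidden_limit /aligned.
move: (\sum_(e in S) hidden_profit e) (\sum_(e in T) hidden_profit e) => pS pT.
move: hQ kS; rewrite /in_Q; case: P => -[g F] b /=.
have [Sk|Sk] := eqVneq #|S| k; last first.
  have {}small : #|S| * (n * n) + index_sum S < k * (n * n).
    by apply: small; rewrite ltn_neqAle Sk.
  case: F => [_ /(_ erefl) Sk'|]; first by rewrite Sk' eqxx in Sk.
  move: small; set a := #|S| * _; set b0 := k * _ => small; clearbody a b0.
  (* A smaller set is too light for [Ge] and has too little profit for [Max] with [Le]; it could win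
     only for [(Min, IS, Le)], which [hQ] excludes. *)
  by case: g; case: b => /= hQ _; try (by case: hQ); rewrite ler_nat; lia.
rewrite Sk; have {}sumS := sumS Sk.
move: (k * (k.*2 * k.*2)) => b0.
by case: g; case: b => /= _ _; rewrite ler_nat; lia.
Qed.

Lemma approx_candidate (R : realType) (eps : R) S : in_Q P ->
  (0 < eps)%R -> (eps * (n ^ 3)%:R < 1)%R ->
  approx_solution P (I := hidden_instance T) (1 + eps)%R S -> S = T.
Proof.
move=> hQ eps_gt0 eps_lt /andP[solS /existsP[U]].
move=> /andP[/andP[solU /forallP optU]].
have := implyP (optU T) candidate_solution.
have := @other_solution_worse S hQ solS.
have profitT : (eps * (\sum_(e in T) hidden_profit e)%:R < 1)%R.
  apply: le_lt_trans eps_lt; rewrite ler_pM2l // ler_nat.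
  exact: profit_candidate_le.
rewrite ![sum_over _ _]sum_over_natr ![ratr _%:R%R]ratr_nat.
case: eqVneq => // _ /(_ isT).
move: profitT.
move: (\sum_(e in T) _) (\sum_(e in S) _) (\sum_(e in U) _) => pT pS pU.
(* Integrality turns the strict inequality into a gap of at least one, more than the slack
   [eps * pT < 1] permits. *)
case: (P.1.1) => profitT; rewrite -(ler_nat R) -natr1 ler_nat -(ler_nat R).
  move=> leST leTU; rewrite ler_pdivrMr; last by lra.
  by move=> leUS; exfalso; nra.
by move=> leTS leUT leSU; exfalso; nra.
Qed.

End Candidate.

(** Bounding bit lengths linearly by the numbers themselves suffices, as these are polynomial in
    [n]. *)
Lemma hidden_size T : (L < n * n) ->
  instance_size (hidden_instance T) <= 12 * n ^ 3.
Proof.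
move=> ltL; have n_gt0 : 0 < n by rewrite double_gt0.
rewrite /instance_size /=.
have s_lim := rat_size_nat hidden_limit.
have s_sum : (\sum_(e < n) (rat_size (hidden_profit e)%:R%R +
    rat_size (hidden_weight e)%:R) <= n * (2 * (2 * (n * n) + 2))).
  rewrite -[X in (_ <= X * _)]card_ord -sum_nat_const; apply: leq_sum => e _.
  have := rat_size_nat (hidden_profit e).
  have := rat_size_nat (hidden_weight e).
  have := ltn_ord e; rewrite /hidden_weight /hidden_profit.
  by case: aligned; nia.
apply: leq_trans (leq_add (leq_add (leqnn _) s_lim) s_sum) _.
by rewrite /hidden_limit; move: ltL n_gt0; rewrite -mul2n; nia.
Qed.

Lemma few_candidates (R : realType) (A : program) (eps : R) (t : nat) :
  in_Q P -> (0 < eps)%R -> (eps * (n ^ 3)%:R < 1)%R ->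
  randomized_approx P (1 + eps)%R A ->
  (forall T, halts_within A (hidden_instance T) t) ->
  #|level n k L| <= 2 * t.
Proof.
move=> hQ eps_gt0 eps_lt approxA haltsA.
pose o S := S \in indep (hidden_matroid set0).
pose hits (coins : t.-tuple bool) :=
  touched o A (init (hidden_instance set0)) coins.
apply: (@half_covered_family _ _ _ t hits) => [coins||T T_level].
- by rewrite -[X in (_ <= X)](size_tuple coins) size_touched.
- by rewrite card_tuple card_bool expn_gt0.
have [u haltsu [/(_ (ex_intro _ T (candidate_solution T_level))) half _]] :=
  approxA (hidden_instance T).
rewrite card_tuple card_bool -(ler_nat R) natrM.
have pow_gt0 : (0 < (2 ^ t)%:R :> R)%R by rewrite ltr0n expn_gt0.
rewrite (prob_halted _ _ (haltsA T) haltsu) /prob ler_pdivlMr // in half.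
rewrite -ler_pdivrMl // (le_trans half) // ler_nat.
apply/subset_leq_card/subsetP => coins; rewrite !inE /returns_approx.
case returnE: (returned _) => [[X|]|//] //.
move=> /(approx_candidate T_level hQ eps_gt0 eps_lt) XT.
rewrite {X}XT in returnE.
have [//|notouch] := boolP (T \in hits coins).
have same S : S != T -> o S = (S \in indep (hidden_matroid T)).
  move=> /negbTE ST; rewrite /o !hidden_indep ST /=.
  have [->|//] := eqVneq S set0.
  by rewrite inE cards0 (ltn_eqF k_gt0).
(* The explicit data do not depend on [T], so both runs start from the same configuration and differ
   only in the oracle. *)
have := touched_same same notouch; move: returnE; rewrite /run => + runE.
rewrite [X in returned X](runE) => /returned_touched[//|].
by rewrite (negbTE notouch).
Qed.

End HiddenSet.

(** * Choice of the parameters and contradiction *)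

Theorem theorem1p1 (R : realType) (P : problem) (hP : in_Q P) :
  ~ exists A : R -> program, fully_PTAS P A.
Proof.
move=> [A [approxA [c timeA]]].
(* The constants come from expanding [n * n * (2 * t)] with [n = 2 * k] and the [t] below. *)
have [k k_gt0 large] :=
  exp_beats_poly (2 * c * 24 ^ c * 2 ^ (6 * c + 2)) (6 * c + 2).
have n_gt0 : (0 < k.*2) by rewrite double_gt0.
set n := k.*2 in n_gt0.
(* [n ^ 3] bounds the profit of a candidate; the factor 2 makes [eps * n ^ 3 < 1] strict. *)
pose eps : R := (2 * n ^ 3)%:R^-1%R.
have eps_gt0 : (0 < eps)%R by rewrite invr_gt0 ltr0n; nia.
have eps_le1 : (eps <= 1)%R by rewrite invf_le1 ?ler1n ?ltr0n; nia.
have eps_lt : (eps * (n ^ 3)%:R < 1)%R.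
  by rewrite mulrC ltr_pdivrMr ?mul1r ?ltr_nat ?ltr0n; nia.
(* Instance size at most [12 * n ^ 3], times [1 / eps = 2 * n ^ 3]. *)
pose t := (c * (24 * n ^ 6) ^ c).
have few L : #|level n k L| <= 2 * t.
  have [ltL|geL] := ltnP L (n * n); last first.
    suff -> : level n k L = set0 by rewrite cards0.
    apply/setP => S; rewrite !inE; apply/negbTE/negP => /andP[_ /eqP SL].
    by have := index_sum_lt S n_gt0; rewrite SL ltnNge geL.
  apply: (few_candidates hP eps_gt0 eps_lt (approxA eps eps_gt0)) => // T.
  have [u le_ut haltsu] := timeA eps (hidden_instance P k_gt0 L T) eps_gt0.
  apply: halts_withinW haltsu; rewrite -(ler_nat R) (le_trans le_ut) //.
  rewrite min_r // /eps invrK -natrM -natrX -natrM ler_nat leq_mul2l.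
  have [->//|c_gt0] := posnP c; rewrite leq_exp2r //.
  by have := hidden_size P k_gt0 T ltL; rewrite -/n; nia.
(* This gives [2 ^ k <= n * n * (2 * t)], against the choice of [k]. *)
have := leq_trans (expn2_le_central_bin k) (central_bin_le_levels k_gt0 few).
apply/negP; rewrite -ltnNge; apply: leq_trans large; rewrite ltnS.
suff -> : n * n * (2 * t) =
    2 * c * 24 ^ c * 2 ^ (6 * c + 2) * k ^ (6 * c + 2) by [].
rewrite -[in RHS]mulnA -expnMn /t /n -mul2n.
by rewrite expnD [(2 * k) ^ (6 * c)]expnM expnMn; ring.
Qed.
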